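(* Let $a,b\geq3$ be odd integers and $n\equiv6\pmod8$ an integer such that $b\nmid v_p(n)$ for every prime divisor $p\equiv3\pmod4$ of $an$. Then $x^2+y^2+z^{ab}=n^a$ has no solution in $\mathbb{Z}^3$, although $\mathfrak X(\mathbb{Z}_v)\neq\emptyset$ for every place $v$; moreover, this is explained by a Brauer--Manin obstruction: $\sum_v\operatorname{inv}_vA(P_v)=1/2$ for every $(P_v)_v\in\prod_v\mathfrak X(\mathbb{Z}_v)$. In particular the integral Hasse principle fails.
   Context: $\mathfrak X=\operatorname{Spec}\mathbb{Z}[X,Y,Z]/(X^2+Y^2+Z^{ab}-n^a)$; $\mathfrak X(R)$ is the set of solutions in $R^3$. Places $v$ are primes and $\infty$; $\mathbb{Z}_\infty=\mathbb{Q}_\infty=\mathbb{R}$. For $u\in\mathbb{Q}_v^\times$, $(u,-1)_v=1$ if $u$ is a sum of two squares in $\mathbb{Q}_v$, else $-1$. Let $g(Z)=\sum_{i=0}^{a-1}n^{a-1-i}Z^{ib}$, so $n^a-Z^{ab}=(n-Z^b)g(Z)$. $A$ is the Azumaya algebra on $\mathfrak X_\mathbb{Q}$ given by the quaternion algebra $(n-Z^b,-1)$ on $D(n-Z^b)$ and $(g(Z),-1)$ on $D(g(Z))$, glued via $i\mapsto(Xi'+Yi'j')/g(Z)$, $j\mapsto j'$. For $P=(x,y,z)\in\mathfrak X(\mathbb{Q}_v)$, $\operatorname{inv}_vA(P)\in\{0,1/2\}\subset\mathbb{Q}/\mathbb{Z}$ is $0$ iff $(n-z^b,-1)_v=1$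 when $n\neq z^b$, and $0$ iff $(g(z),-1)_v=1$ when $g(z)\neq0$. *)

(* Defs.v *)
From HB Require Import structures.
From mathcomp Require Import all_boot all_order all_algebra.
From mathcomp Require Import ring.
From mathcomp Require Import boolp classical_sets cardinality fsbigop reals.

Set Implicit Arguments.
Unset Strict Implicit.
Unset Printing Implicit Defensive.

Import Order.TTheory GRing.Theory Num.Theory.

Local Open Scope ring_scope.

Definition prime_number : Type := {p : nat | prime p}.

(* Z_p as the inverse limit of the rings Z/p^(k+1), k >= 0. The exponent starts
   at 1 because 'Z_1 denotes Z/2; the omitted term Z/p^0 is the zero ring. *)
Record padic_int (p : prime_number) : Type := PadicInt {
  residue : forall k : nat, 'Z_(val p ^ k.+1);
  residueP : forall k : nat,
    (residue k.+1 : nat)%:R = residue k :> 'Z_(val p ^ k.+1) }.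

HB.instance Definition _ (p : prime_number) := gen_eqMixin (padic_int p).
HB.instance Definition _ (p : prime_number) := gen_choiceMixin (padic_int p).

Section PadicRing.
Variable p : prime_number.
Implicit Types x y z : padic_int p.
Local Notation q := (val p).

Lemma padic_p_gt1 : (1 < q)%N.
Proof. exact: prime_gt1 (valP p). Qed.

Lemma padic_pX_gt1 k : (1 < q ^ k.+1)%N.
Proof. by rewrite -(exp1n k.+1) ltn_exp2r // padic_p_gt1. Qed.

Lemma padic_eqP x y : (forall k, residue x k = residue y k) -> x = y.
Proof.
case: x y => [x xP] [y yP] /= exy.
have {}exy : x = y by apply: functional_extensionality_dep.
by subst y; congr PadicInt; apply: Prop_irrelevance.
Qed.

Lemma Zp_natr_dvd (m m' i j : nat) : (1 < m)%N -> (m %| m')%N ->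
  i = j %[mod m'] -> i%:R = j%:R :> 'Z_m.
Proof.
move=> m1 dm eij; apply: val_inj; rewrite /= !val_Zp_nat //.
by rewrite -(modn_dvdm i dm) eij modn_dvdm.
Qed.

Lemma val_ZpD m (a b : 'Z_m) : (1 < m)%N ->
  ((a + b)%R : nat) = ((a + b) %% m)%N.
Proof. by case: m a b => [|[|m]]. Qed.

Lemma val_ZpM m (a b : 'Z_m) : (1 < m)%N ->
  ((a * b)%R : nat) = ((a * b) %% m)%N.
Proof. by case: m a b => [|[|m]]. Qed.

Lemma dvd_pXS k : (q ^ k.+1 %| q ^ k.+2)%N.
Proof. by rewrite dvdn_exp2l. Qed.

Fact padic0P k : ((0 : 'Z_(q ^ k.+2))%R : nat)%:R = 0 :> 'Z_(q ^ k.+1).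
Proof. by []. Qed.
Fact padic1P k : ((1 : 'Z_(q ^ k.+2))%R : nat)%:R = 1 :> 'Z_(q ^ k.+1).
Proof. by rewrite /= modn_small. Qed.
Fact padicDP x y k :
  ((residue x k.+1 + residue y k.+1)%R : nat)%:R
  = residue x k + residue y k :> 'Z_(q ^ k.+1).
Proof.
rewrite -(residueP x k) -(residueP y k) -natrD.
apply: Zp_natr_dvd (dvd_pXS k) _; first exact: padic_pX_gt1.
by rewrite val_ZpD ?padic_pX_gt1 // modn_mod.
Qed.
Fact padicMP x y k :
  ((residue x k.+1 * residue y k.+1)%R : nat)%:R
  = residue x k * residue y k :> 'Z_(q ^ k.+1).
Proof.
rewrite -(residueP x k) -(residueP y k) -natrM.
apply: Zp_natr_dvd (dvd_pXS k) _; first exact: padic_pX_gt1.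
by rewrite val_ZpM ?padic_pX_gt1 // modn_mod.
Qed.
Fact padicNP x k :
  ((- residue x k.+1)%R : nat)%:R = - residue x k :> 'Z_(q ^ k.+1).
Proof.
apply/eqP; rewrite -subr_eq0 opprK -(residueP x k) -natrD; apply/eqP.
rewrite -[RHS]/(0%:R).
apply: Zp_natr_dvd (dvd_pXS k) _; first exact: padic_pX_gt1.
by rewrite -val_ZpD ?padic_pX_gt1 // addNr mod0n.
Qed.

Definition padic_zero := PadicInt padic0P.
Definition padic_one := PadicInt padic1P.
Definition padic_add x y := PadicInt (padicDP x y).
Definition padic_mul x y := PadicInt (padicMP x y).
Definition padic_opp x := PadicInt (padicNP x).

Fact padic_addA : associative padic_add.
Proof. by move=> x y z; apply: padic_eqP => k /=; rewrite addrA. Qed.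
Fact padic_addC : commutative padic_add.
Proof. by move=> x y; apply: padic_eqP => k /=; rewrite addrC. Qed.
Fact padic_add0 : left_id padic_zero padic_add.
Proof. by move=> x; apply: padic_eqP => k /=; rewrite add0r. Qed.
Fact padic_addN : left_inverse padic_zero padic_opp padic_add.
Proof. by move=> x; apply: padic_eqP => k /=; rewrite addNr. Qed.
HB.instance Definition _ := GRing.isZmodule.Build (padic_int p)
  padic_addA padic_addC padic_add0 padic_addN.

Fact padic_mulA : associative padic_mul.
Proof. by move=> x y z; apply: padic_eqP => k /=; rewrite mulrA. Qed.
Fact padic_mulC : commutative padic_mul.
Proof. by move=> x y; apply: padic_eqP => k /=; rewrite mulrC. Qed.
Fact padic_mul1 : left_id padic_one padic_mul.
Proof. by move=> x; apply: padic_eqP => k /=; rewrite mul1r. Qed.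
Fact padic_mulDl : left_distributive padic_mul padic_add.
Proof. by move=> x y z; apply: padic_eqP => k /=; rewrite mulrDl. Qed.
Fact padic_one_neq0 : padic_one != 0.
Proof.
apply/eqP => /(congr1 (fun x => residue x 0)) /= /eqP.
by rewrite oner_eq0.
Qed.
HB.instance Definition _ := GRing.Zmodule_isComNzRing.Build (padic_int p)
  padic_mulA padic_mulC padic_mul1 padic_mulDl padic_one_neq0.

Definition padic_unit : {pred padic_int p} := fun x => `[< exists y, y * x = 1 >].
Definition padic_inv x : padic_int p :=
  if pselect (exists y, y * x = 1) is left ex then sval (cid ex) else x.

Fact padic_mulV : {in padic_unit, left_inverse 1 padic_inv *%R}.
Proof.
move=> x /asboolP ux; rewrite /padic_inv; case: pselect => // ex.
by case: cid.
Qed.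
Fact padic_unitP x y : y * x = 1 -> x \in padic_unit.
Proof. by move=> xy; apply/asboolP; exists y. Qed.
Fact padic_inv_out : {in [predC padic_unit], padic_inv =1 id}.
Proof.
move=> x /asboolPn ux; rewrite /padic_inv; case: pselect => //.
Qed.
HB.instance Definition _ := GRing.ComNzRing_hasMulInverse.Build (padic_int p)
  padic_mulV padic_unitP padic_inv_out.

Lemma residue_mod x k j :
  (residue x (k + j)%N : nat) = residue x k %[mod q ^ k.+1].
Proof.
elim: j => [|j IH]; first by rewrite addn0.
rewrite -IH addnS -(residueP x (k + j)) val_Zp_nat ?padic_pX_gt1 //.
by rewrite modn_dvdm // dvdn_exp2l // ltnS leq_addr.
Qed.

Lemma residue_neq0 x : x != 0 ->
  exists i, forall j, ~~ (q ^ i.+1 %| (residue x (i + j)%N : nat))%N.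
Proof.
move=> x0; have [i xi] : exists i, residue x i != 0.
  apply: contrapT => xE; case/eqP: x0; apply: padic_eqP => k.
  by apply/eqP/negPn/negP => xk; apply: xE; exists k.
exists i => j; rewrite /dvdn residue_mod modn_small.
  by apply: contraNneq xi => xi0; apply/eqP/val_inj.
by case: (residue x i) => m /=; rewrite Zp_cast ?padic_pX_gt1.
Qed.

Fact padic_idomain x y : x * y = 0 -> (x == 0) || (y == 0).
Proof.
move=> xy0; have [//|/residue_neq0[i xi]] := eqVneq x 0.
have [//|/residue_neq0[j yj]] := eqVneq y 0.
have dab : (q ^ (i + j).+2 %|
    (residue x (i + j).+1 : nat) * (residue y (i + j).+1 : nat))%N.
  rewrite /dvdn -val_ZpM ?padic_pX_gt1 //.
  by rewrite -[(_ * _)%R]/(residue (x * y) (i + j).+1) xy0.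
move: (xi j.+1) (yj i.+1) dab; rewrite !addnS (addnC j i).
move: (nat_of_ord (residue x _)) (nat_of_ord (residue y _)) => a b na nb dab.
exfalso.
have a0 : (0 < a)%N by rewrite lt0n; apply: contraNneq na => ->.
have b0 : (0 < b)%N by rewrite lt0n; apply: contraNneq nb => ->.
have pq : prime q := valP p.
move: dab na nb; rewrite !pfactor_dvdn ?muln_gt0 ?a0 // lognM //.
rewrite -!ltnNge !ltnS => h la lb.
by have := leq_trans h (leq_add la lb); rewrite ltnNge leqW.
Qed.
HB.instance Definition _ :=
  GRing.ComUnitRing_isIntegral.Build (padic_int p) padic_idomain.

End PadicRing.

Variant place : Type := FinitePlace of prime_number | InfinitePlace.

Definition place_to_option (v : place) : option prime_number :=
  if v is FinitePlace p then Some p else None.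
Definition option_to_place (o : option prime_number) : place :=
  if o is Some p then FinitePlace p else InfinitePlace.
Lemma place_to_optionK : cancel place_to_option option_to_place.
Proof. by case. Qed.
HB.instance Definition _ := Choice.copy place (can_type place_to_optionK).

(* Z_v, with the convention that Z_oo = Q_oo is the field of real numbers. *)
Definition local_ring (R : realType) (v : place) : idomainType :=
  match v with FinitePlace p => padic_int p | InfinitePlace => R end.

Definition local_field (R : realType) (v : place) : fieldType :=
  match v with
  | FinitePlace p => {fraction padic_int p}
  | InfinitePlace => R
  end.

Definition local_inj (R : realType) (v : place) :
    local_ring R v -> local_field R v :=
  match v with
  | FinitePlace p => fun x : padic_int p => tofrac x
  | InfinitePlace => fun x : R => x
  end.

Local Open Scope classical_set_scope.

Definition scheme_points (a b : nat) (n : int) (S : comNzRingType) :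
    set (S * S * S) :=
  [set P | P.1.1 ^+ 2 + P.1.2 ^+ 2 + P.2 ^+ (a * b) = n%:~R ^+ a].

Arguments scheme_points a b n S _ : clear implicits.

Definition local_point (R : realType) (v : place)
    (P : local_ring R v * local_ring R v * local_ring R v) :
    local_field R v * local_field R v * local_field R v :=
  (local_inj P.1.1, local_inj P.1.2, local_inj P.2).

Lemma local_pointP (R : realType) (a b : nat) (n : int) (v : place)
    (P : local_ring R v * local_ring R v * local_ring R v) :
  scheme_points a b n (local_ring R v) P ->
  scheme_points a b n (local_field R v) (local_point P).
Proof.
case: v P => [p|] [[x y] z] //= h.
have := congr1 (@FracField.tofrac (padic_int p)) h.
by rewrite !rmorphD !rmorphXn /= rmorph_int.
Qed.

Definition everywhere_locally_soluble (R : realType) (a b : nat) (n : int) : Prop :=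
  forall v : place, scheme_points a b n (local_ring R v) !=set0.

Definition integral_Hasse_principle (R : realType) (a b : nat) (n : int) : Prop :=
  everywhere_locally_soluble R a b n -> scheme_points a b n int !=set0.

(* The symbol (u, -1)_v, meant for u nonzero in K = Q_v. *)
Definition hilbert_m1 (K : fieldType) (u : K) : int :=
  if `[< exists c d : K, u = c ^+ 2 + d ^+ 2 >] then 1 else -1.

Definition rat_int : pred rat := fun x => x \is a Num.int.
Fact rat_int_zmod_closed : zmod_closed rat_int.
Proof.
by split=> [|x y]; rewrite /rat_int !unfold_in; [exact: rpred0 | exact: rpredB].
Qed.
HB.instance Definition _ :=
  GRing.isZmodClosed.Build rat rat_int rat_int_zmod_closed.
Definition rat_mod_int : zmodType := Quotient.quot (GRing.ZmodClosed.clone rat rat_int _).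
Definition to_rat_mod_int (x : rat) : rat_mod_int := (\pi_rat_mod_int x)%qT.

Lemma to_rat_mod_int_eq0 (x : rat) :
  (to_rat_mod_int x == 0) = (x \is a Num.int).
Proof.
have <- : to_rat_mod_int 0 = 0 by exact: pi_zeror.
rewrite /to_rat_mod_int -[LHS]Quotient.idealrBE subr0.
by rewrite unfold_in.
Qed.

Definition cofactor_poly (a b : nat) (n : int) (K : fieldType) (z : K) : K :=
  \sum_(i < a) n%:~R ^+ (a - 1 - i) * z ^+ (i * b).

(* inv_v of the quaternion algebra (u, -1) over K = Q_v *)
Definition inv_quaternion (K : fieldType) (u : K) : rat_mod_int :=
  if hilbert_m1 u == 1 then 0 else to_rat_mod_int (1 / 2).

(* inv_v A(P) for P in X(K), K = Q_v. The algebra A is (n - Z^b, -1) on the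
   chart n - Z^b <> 0 and (g(Z), -1) on the chart g(Z) <> 0; on the overlap the
   two formulas agree, see inv_A_chart2. *)
Definition inv_A (a b : nat) (n : int) (K : fieldType) (P : K * K * K) :
    rat_mod_int :=
  let z := P.2 in
  if n%:~R != z ^+ b then inv_quaternion (n%:~R - z ^+ b)
  else inv_quaternion (cofactor_poly a b n z).

Lemma cofactor_polyE (a b : nat) (n : int) (K : fieldType) (z : K) :
  n%:~R ^+ a - z ^+ (a * b) = (n%:~R - z ^+ b) * cofactor_poly a b n z.
Proof.
rewrite mulnC exprM subrXX; congr (_ * _); apply: eq_bigr => i _.
by rewrite -exprM subn1 (mulnC b).
Qed.

Lemma inv_A_chart1 (a b : nat) (n : int) (K : fieldType) (P : K * K * K) :
  n%:~R != P.2 ^+ b -> inv_A a b n P = inv_quaternion (n%:~R - P.2 ^+ b).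
Proof. by rewrite /inv_A => ->. Qed.

Lemma inv_A_chart2 (a b : nat) (n : int) (K : fieldType) (P : K * K * K) :
  scheme_points a b n K P -> cofactor_poly a b n P.2 != 0 ->
  inv_A a b n P = inv_quaternion (cofactor_poly a b n P.2).
Proof.
case: P => [[x y] z] /= eP g0; rewrite /inv_A /=; case: ifPn => // u0.
have {}u0 : n%:~R - z ^+ b != 0 by rewrite subr_eq0.
have := cofactor_polyE a b n z.
rewrite -eP addrK; set u := _ - _ in u0 *; set g := cofactor_poly _ _ _ _ in g0 *.
move=> ug; rewrite /inv_quaternion /hilbert_m1.
suff -> : (exists c d, u = c ^+ 2 + d ^+ 2) = (exists c d, g = c ^+ 2 + d ^+ 2).
  by [].
have swap (s t : K) : s != 0 -> x ^+ 2 + y ^+ 2 = s * t ->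
    (exists c d, s = c ^+ 2 + d ^+ 2) -> exists c d, t = c ^+ 2 + d ^+ 2.
  move=> s0 st [c [d sE]]; exists ((x * c + y * d) / s), ((x * d - y * c) / s).
  apply: (mulfI s0); rewrite -st !expr_div_n -mulrDl.
  have -> : (x * c + y * d) ^+ 2 + (x * d - y * c) ^+ 2
          = (x ^+ 2 + y ^+ 2) * s.
    by rewrite sE; ring.
  by field.
by apply/propext; split; apply: swap => //; rewrite mulrC.
Qed.

(* Main.v *)
From HB Require Import structures.
Require Import Defs.
From mathcomp Require Import all_boot all_order all_algebra all_field.
From mathcomp Require Import ring zify.
From mathcomp Require Import boolp classical_sets cardinality fsbigop reals.

(* On the curve, (n - z^b) g(z) = x^2 + y^2, and g(z) = a n^(a-1) modulo
   n - z^b. At an odd p not dividing an, either n - z^b or g(z) is therefore a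
   unit of Z_p, hence a sum of two squares. If p = 1 mod 4, every element of Z_p
   is a sum of two squares. If p = 3 mod 4 divides an, then b does not divide
   v_p(n), so v_p(n) <> v_p(z^b), and g(z) is an even power of p times a unit.
   At the real place n - z^b >= 0 because a is odd. So inv_v A vanishes for
   v <> 2. At 2, a computation modulo 8 gives n - z^b = 3, 6 or 7 mod 8, which
   is never a sum of two squares in Q_2.
   Global reciprocity is replaced by an elementary argument: for an integral
   point, n - z^b is a positive integer congruent to 3, 6 or 7 mod 8, so some
   prime p = 3 mod 4 divides it to an odd power, and inv_p A would be 1/2. *)

Set Implicit Arguments.
Unset Strict Implicit.
Unset Printing Implicit Defensive.

Import Order.TTheory GRing.Theory Num.Theory.

Local Open Scope ring_scope.
Local Open Scope classical_set_scope.

(** * Arithmetic of the p-adic integers *)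

Section PadicIntegers.
Variable p : prime_number.
Implicit Types (x y z u : padic_int p) (k j m : nat).
Local Notation q := (val p).
Local Notation resn x k := (nat_of_ord (residue x k)).

Lemma residueD x y k : residue (x + y) k = residue x k + residue y k.
Proof. by []. Qed.

Lemma residueB x y k : residue (x - y) k = residue x k - residue y k.
Proof. by []. Qed.

Lemma residueM x y k : residue (x * y) k = residue x k * residue y k.
Proof. by []. Qed.

Lemma residueX x m k : residue (x ^+ m) k = residue x k ^+ m.
Proof. by elim: m => // m IH; rewrite !exprS residueM IH. Qed.

Lemma residue_nat m k : residue (m%:R : padic_int p) k = m%:R.
Proof. by elim: m => // m IH; rewrite -!natr1 residueD IH. Qed.

Lemma residue_int (m : int) k : residue (m%:~R : padic_int p) k = m%:~R.
Proof.
case: m => m; last rewrite NegzE !mulrNz; first exact: residue_nat.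
exact: (congr1 -%R (residue_nat m.+1 k)).
Qed.

Lemma ltn_residue x k : (resn x k < q ^ k.+1)%N.
Proof.
by case: (residue x k) => m /=; rewrite Zp_cast ?padic_pX_gt1.
Qed.

Lemma natr_residue x k : (resn x k)%:R = residue x k.
Proof. exact: natr_Zp. Qed.

Lemma residue_natr_eq0 m k :
  (m%:R == 0 :> 'Z_(q ^ k.+1)) = (q ^ k.+1 %| m)%N.
Proof. by rewrite -val_eqE /= val_Zp_nat ?padic_pX_gt1. Qed.

Lemma residue_eq0 x k : (residue x k == 0) = (q ^ k.+1 %| resn x k)%N.
Proof. by rewrite -residue_natr_eq0 natr_residue. Qed.

Lemma modn_residue x k j : (resn x (k + j) %% q ^ k.+1)%N = resn x k.
Proof. by rewrite residue_mod modn_small ?ltn_residue. Qed.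

Lemma dvdn_residue x k : (q %| resn x k)%N = (residue x 0 == 0).
Proof. by rewrite residue_eq0 -(modn_residue x 0 k) /dvdn modn_mod expn1. Qed.

Lemma residue_eq0_le x k j : (j <= k)%N -> residue x k = 0 -> residue x j = 0.
Proof.
move=> jk xk; apply/eqP; rewrite residue_eq0 /dvdn.
by rewrite -(subnKC jk) in xk; rewrite -(residue_mod x j (k - j)) xk mod0n.
Qed.

Lemma residue_eq0_dvd x k :
  residue x k = 0 -> exists y, x = (q ^ k.+1)%:R * y.
Proof.
(* Division by q^(k+1) loses k+1 digits, so the quotient modulo q^(j+1) is read off [x] modulo
   q^(k+j+2). *)
move=> xk; pose s j := (resn x (k.+1 + j) %/ q ^ k.+1)%N.
have sP j :
    (((s j.+1)%:R : 'Z_(q ^ j.+2)) : nat)%:R = (s j)%:R :> 'Z_(q ^ j.+1).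
  apply: val_inj => /=; rewrite !val_Zp_nat ?padic_pX_gt1 //.
  rewrite modn_dvdm ?dvd_pXS // [RHS]modn_small.
    rewrite /s modn_divl; have -> : (q ^ j.+1 * q ^ k.+1 = q ^ (k.+1 + j).+1)%N.
      by rewrite -expnD addnC addnS.
    by rewrite -(modn_residue x (k.+1 + j) 1) addn1 addnS.
  rewrite ltn_divLR ?expn_gt0 ?prime_gt0 ?(valP p) // -expnD.
  by rewrite [(j.+1 + _)%N]addnC addnS ltn_residue.
exists (PadicInt sP); apply: padic_eqP => j; rewrite residueM residue_nat /=.
rewrite -natrM /s mulnC divnK.
  apply: val_inj => /=; rewrite val_Zp_nat ?padic_pX_gt1 //.
  by rewrite addnC modn_residue.
by rewrite /dvdn addSnnS modn_residue xk.
Qed.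


Lemma residue_mulp m k : (k < m)%N -> residue (q%:R ^+ m : padic_int p) k = 0.
Proof.
move=> km; rewrite -natrX residue_nat; apply/eqP.
by rewrite residue_natr_eq0 dvdn_exp2l.
Qed.

(** A nonzero class modulo p is invertible at every level, and uniqueness of inverses makes the
    levels compatible. *)
Lemma unit_residue x : (x \is a GRing.unit) = (residue x 0 != 0).
Proof.
apply/idP/idP => [ux|x0].
  apply/eqP => x0; have := congr1 (fun y => residue y 0) (divrr ux).
  by rewrite residueM x0 mul0r => /esym/eqP; rewrite oner_eq0.
have uk k : residue x k \is a GRing.unit.
  rewrite -natr_residue unitZpE ?padic_pX_gt1 // coprimeXl //.
  by rewrite prime_coprime ?(valP p) // dvdn_residue.
have yP k : (((residue x k.+1)^-1 : 'Z_(q ^ k.+2)) : nat)%:R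
    = (residue x k)^-1 :> 'Z_(q ^ k.+1).
  apply: (mulrI (uk k)); rewrite divrr ?uk // -{1}(residueP x k) -natrM.
  rewrite -[RHS]/(1%:R); apply: Zp_natr_dvd (dvd_pXS p k) _.
    exact: padic_pX_gt1.
  by rewrite -val_ZpM ?padic_pX_gt1 // divrr ?uk // modn_small ?padic_pX_gt1.
apply/unitrP; exists (PadicInt yP).
by split; apply: padic_eqP => k; rewrite residueM /= ?mulVr ?divrr ?uk.
Qed.

(** The exponent is the least index with nonzero residue: index k is taken modulo q^(k+1), so
    vanishing just below it yields exactly k factors q. *)
Lemma padic_factor x : x != 0 ->
  exists k u, u \is a GRing.unit /\ x = q%:R ^+ k * u.
Proof.
move=> x0; have /ex_minnP[k xk kmin] : exists k, residue x k != 0.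
  apply: contrapT => xE; case/eqP: x0; apply: padic_eqP => k.
  by apply/eqP/negPn/negP => xk; apply: xE; exists k.
case: k => [|k] in xk kmin.
  by exists 0, x; rewrite unit_residue expr0 mul1r.
have /residue_eq0_dvd[u xE] : residue x k = 0.
  by apply/eqP/negPn/negP => /kmin; rewrite ltnn.
exists k.+1, u; rewrite xE natrX; split=> //.
rewrite unit_residue; apply: contra xk => /eqP/residue_eq0_dvd[v uE].
by rewrite xE uE natrX natrX mulrA -exprD residueM residue_mulp ?mul0r // addn1.
Qed.

(** Completeness of Z_p: the diagonal residues are compatible. *)
Lemma padic_limit (s : nat -> padic_int p) :
  (forall k, residue (s k.+1) k = residue (s k) k) ->
  exists x, forall k, residue x k = residue (s k) k.
Proof.
move=> sE; have sP k : ((residue (s k.+1) k.+1) : nat)%:R = residue (s k) k.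
  by rewrite residueP sE.
by exists (PadicInt sP).
Qed.

Lemma residue_sqr_eq0 x k : residue x k = 0 -> residue (x ^+ 2) k.+1 = 0.
Proof.
move=> /residue_eq0_dvd[y ->]; rewrite exprMn natrX -exprM residueM.
by rewrite residue_mulp ?mul0r //; lia.
Qed.

(** Newton iteration from [s], gaining one digit per step. The linear term makes p = 2 accessible,
    where the derivative 2t of t^2 is never a unit. *)
Lemma hensel_quadratic (be ga s : padic_int p) :
  residue (s ^+ 2 + be * s - ga) 0 = 0 -> s *+ 2 + be \is a GRing.unit ->
  exists x, x ^+ 2 + be * x = ga.
Proof.
move=> fs us; pose f (t : padic_int p) : padic_int p := t ^+ 2 + be * t - ga.
pose d (t : padic_int p) : padic_int p := t *+ 2 + be.
pose newton (t : padic_int p) : padic_int p := t - f t / d t.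
have step k (t : padic_int p) : residue (f t) k = 0 -> d t \is a GRing.unit ->
    [/\ residue (f (newton t)) k.+1 = 0, d (newton t) \is a GRing.unit
      & residue (newton t) k = residue t k].
  move=> ftk ut; set h := f t / d t.
  have hk : residue h k = 0 by rewrite residueM ftk mul0r.
  split.
  (* Taylor expansion at [t], exact in degree two; the choice of [h] cancels the linear part. *)
  - have -> : f (newton t) = h ^+ 2 + (f t - h * d t).
      by rewrite /newton -/h /f /d; ring.
    by rewrite divrK // subrr addr0; apply: residue_sqr_eq0.
  - have -> : d (newton t) = d t - h *+ 2 by rewrite /newton -/h /d; ring.
    have h0 : residue (h *+ 2) 0 = 0.
      by rewrite mulr2n residueD (residue_eq0_le _ hk) ?addr0.
    by rewrite unit_residue residueB h0 subr0 -unit_residue.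
  - by rewrite /newton -/h residueB hk subr0.
have inv k : residue (f (iter k newton s)) k = 0
    /\ d (iter k newton s) \is a GRing.unit.
  by elim: k => //= k [fk uk]; case: (step _ _ fk uk).
have [|x xE] := padic_limit (s := fun k => iter k newton s).
  by move=> k /=; case: (step k (iter k newton s)); case: (inv k).
exists x; apply/eqP; rewrite -subr_eq0; apply/eqP; apply: padic_eqP => k.
have [fk _] := inv k; rewrite -[RHS]fk.
by rewrite !(residueB, residueD, residueM, residueX) xE.
Qed.

End PadicIntegers.

(** * Squares in prime fields *)

Lemma Fp_natr_eq (p : nat) (i j : nat) : prime p ->
  (i%:R == j%:R :> 'F_p) = (i == j %[mod p])%N.
Proof. by move=> pp; rewrite -val_eqE /= !val_Fp_nat. Qed.

(** Pigeonhole: with h = (p-1)/2, the h+1 squares i^2 and the h+1 values u - j^2 cannot all be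
    distinct among p classes. *)
Lemma Fp_sum_two_squares (p : nat) (u : 'F_p) : prime p -> odd p ->
  exists s t : 'F_p, s ^+ 2 + t ^+ 2 = u.
Proof.
move=> pp op; pose h := p./2.
have hp : p = (h.*2.+1)%N by rewrite /h -[LHS]odd_double_half op.
have inj (i j : 'I_h.+1) : (i%:R : 'F_p) ^+ 2 = j%:R ^+ 2 -> i = j.
  have [ih jh] := (ltn_ord i, ltn_ord j).
  move/eqP; rewrite eqf_sqr => /orP[|]; last rewrite -addr_eq0 -natrD.
    by rewrite Fp_natr_eq // !modn_small; [move/eqP/val_inj | lia..].
  rewrite (Fp_natr_eq _ 0) // mod0n modn_small; last by lia.
  by rewrite addn_eq0 => /andP[/eqP i0 /eqP j0]; apply: val_inj; rewrite /= i0.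
pose f (x : 'I_h.+1 + 'I_h.+1) : 'F_p :=
  match x with inl i => i%:R ^+ 2 | inr j => u - j%:R ^+ 2 end.
apply: contrapT => nex; have : injective f.
  have no (i j : 'I_h.+1) : i%:R ^+ 2 <> u - j%:R ^+ 2.
    by move=> e; apply: nex; exists i%:R, j%:R; rewrite e subrK.
  move=> [i|i] [j|j] /=.
  - by move/inj->.
  - by move/no.
  - by move/esym/no.
  - by move/addrI/oppr_inj/inj->.
by move/leq_card; rewrite card_sum !card_ord Fp_cast //; lia.
Qed.

Lemma Fp_expr_pred (p : nat) (x : 'F_p) : prime p -> x != 0 -> x ^+ p.-1 = 1.
Proof.
move=> pp x0; apply: (mulfI x0).
rewrite mulr1 -exprS prednK ?prime_gt0 // -[RHS]expf_card.
by rewrite card_Fp.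
Qed.

(** For p = 4k+1, X^(2k) - 1 cannot vanish on all 4k nonzero classes. If x is not a root, x^(2k) is
    a square root of 1 other than 1, so x^k squares to -1. *)
Lemma Fp_sqrtN1 (p : nat) : prime p -> (p %% 4 = 1)%N ->
  exists s : 'F_p, s ^+ 2 = -1.
Proof.
move=> pp p1; pose k := (p %/ 4)%N; have pE : (p = 4 * k + 1)%N by lia.
have k0 : (0 < k)%N by have := prime_gt1 pp; lia.
have [x [x0 x1]] : exists x : 'F_p, x != 0 /\ x ^+ (2 * k) != 1.
  apply: contrapT => nex.
  have := @max_poly_roots 'F_p ('X^(2 * k) - 1%:P)
    [seq x <- enum 'F_p | x != 0].
  have sz : size ('X^(2 * k) - 1%:P : {poly 'F_p}) = (2 * k).+1.
    by rewrite size_XnsubC // muln_gt0.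
  rewrite sz -size_poly_gt0 sz => /(_ isT) h.
  have := h _ (filter_uniq _ (enum_uniq _)).
  have -> : size [seq x <- enum 'F_p | x != 0] = p.-1.
    have := count_predC (pred1 (0 : 'F_p)) (enum 'F_p).
    rewrite -cardE card_Fp // count_uniq_mem ?enum_uniq // mem_enum /=.
    rewrite size_filter.
    by rewrite add1n => e; rewrite -[p in RHS]e.
  suff -> : all (root ('X^(2 * k) - 1%:P)) [seq x <- enum 'F_p | x != 0].
    by move=> /(_ isT); lia.
  apply/allP => x; rewrite mem_filter => /andP[x0 _].
  rewrite /root !hornerE subr_eq0; apply/negPn/negP => x1.
  by apply: nex; exists x.
have := Fp_expr_pred pp x0.
rewrite (_ : p.-1 = (k * 2 * 2)%N); last by lia.
rewrite 2!exprM => /eqP; rewrite sqrf_eq1 -exprM mulnC (negPf x1) /=.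
rewrite mulnC exprM => /eqP.
by exists (x ^+ k).
Qed.

(** For nonzero t, s/t would square to -1; since (p-1)/2 is odd, its (p-1)-th power would be -1,
    against Fermat's little theorem. *)
Lemma Fp_sum_squares_eq0 (p : nat) (s t : 'F_p) : prime p -> (p %% 4 = 3)%N ->
  s ^+ 2 + t ^+ 2 = 0 -> s = 0 /\ t = 0.
Proof.
move=> pp p3; pose k := (p %/ 4)%N; have pE : (p = 4 * k + 3)%N by lia.
have [-> | t0] := eqVneq t 0.
  by rewrite expr0n addr0 => /eqP; rewrite sqrf_eq0 => /eqP.
move/eqP; rewrite addr_eq0 => /eqP st.
have : (s / t) ^+ 2 = -1.
  by rewrite expr_div_n st mulNr divff // sqrf_eq0.
move=> m1; have r0 : s / t != 0.
  apply/eqP => r0; move: m1; rewrite r0 expr0n => /esym/eqP.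
  by rewrite oppr_eq0 oner_eq0.
have := Fp_expr_pred pp r0.
rewrite (_ : p.-1 = (2 * (2 * k).+1)%N); last by lia.
rewrite exprM m1 -signr_odd /= oddM /= expr1 => /esym/eqP.
rewrite -addr_eq0 -(natrD _ 1 1) (Fp_natr_eq _ 0) // mod0n modn_small //.
by lia.
Qed.

(** * Reduction of Z_p onto its residue field *)

Section Reduction.
Variable p : prime_number.
Local Notation q := (val p).
Implicit Types (x y u : padic_int p).

(** [residue x 0] lies in the ring ['Z_(q ^ 1)]; passing through [nat] places it in the field
    ['F_q]. *)
Definition reduction x : 'F_q := (nat_of_ord (residue x 0))%:R.

Lemma reductionD x y : reduction (x + y) = reduction x + reduction y.
Proof.
apply/eqP; rewrite /reduction -natrD Fp_natr_eq ?(valP p) // residueD.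
by rewrite val_ZpD ?padic_pX_gt1 // modn_dvdm ?dvdn_exp.
Qed.

Lemma reductionM x y : reduction (x * y) = reduction x * reduction y.
Proof.
apply/eqP; rewrite /reduction -natrM Fp_natr_eq ?(valP p) // residueM.
by rewrite val_ZpM ?padic_pX_gt1 // modn_dvdm ?dvdn_exp.
Qed.

Lemma reduction_is_zmod_morphism : zmod_morphism reduction.
Proof.
by move=> x y; apply: (addIr (reduction y)); rewrite -reductionD !subrK.
Qed.

Lemma reduction_is_monoid_morphism : monoid_morphism reduction.
Proof.
split; last exact: reductionM.
by apply/eqP; rewrite /reduction (Fp_natr_eq _ 1) ?(valP p).
Qed.

HB.instance Definition _ := GRing.isZmodMorphism.Build (padic_int p) 'F_q
  reduction reduction_is_zmod_morphism.
HB.instance Definition _ := GRing.isMonoidMorphism.Build (padic_int p) 'F_q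
  reduction reduction_is_monoid_morphism.

Lemma reduction_eq0 x : (reduction x == 0) = (residue x 0 == 0).
Proof.
by rewrite /reduction (Fp_natr_eq _ 0) ?(valP p) // mod0n -(dvdn_residue x 0).
Qed.

Lemma unit_reduction x : (x \is a GRing.unit) = (reduction x != 0).
Proof. by rewrite unit_residue reduction_eq0. Qed.

Lemma reduction_eq0_dvd x : reduction x = 0 -> exists y, x = q%:R * y.
Proof.
move=> /eqP; rewrite reduction_eq0 => /eqP/residue_eq0_dvd[y ->].
by exists y; rewrite expn1.
Qed.

Lemma reduction_p : reduction q%:R = 0.
Proof. by rewrite rmorph_nat pchar_Fp_0 // (valP p). Qed.

Lemma reduction_surj (s : 'F_q) : exists x, reduction x = s.
Proof. by exists (nat_of_ord s)%:R; rewrite rmorph_nat natr_Zp. Qed.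

Lemma padic_p_neq0 : (q%:R : padic_int p) != 0.
Proof.
apply/eqP => p0; have := residue_nat p q 1; rewrite p0 => /esym/eqP.
rewrite residue_natr_eq0 => /dvdn_leq; rewrite prime_gt0 ?(valP p) //.
by rewrite -{2}(expn1 q) leq_exp2l ?padic_p_gt1 // => /(_ isT).
Qed.

End Reduction.

(** * Sums of two squares in Z_p and Q_p *)

Definition two_squares (K : nzRingType) (u : K) : Prop :=
  exists c d, u = c ^+ 2 + d ^+ 2.

Lemma two_squares_rmorph (K L : nzRingType) (f : {rmorphism K -> L}) (u : K) :
  two_squares u -> two_squares (f u).
Proof.
by move=> [c [d ->]]; exists (f c), (f d); rewrite rmorphD !rmorphXn.
Qed.

Lemma two_squares_sqrM (K : comNzRingType) (e u : K) :
  two_squares u -> two_squares (e ^+ 2 * u).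
Proof.
by move=> [c [d ->]]; exists (e * c), (e * d); rewrite mulrDr !exprMn.
Qed.

Lemma fractionP (D : idomainType) (x : {fraction D}) :
  exists a b : D, b != 0 /\ x = tofrac a / tofrac b.
Proof.
elim/quotW: x => r; exists (\n_r), (\d_r); split; first exact: denom_ratioP.
have d0 : tofrac (\d_r) != 0 :> {fraction D} by rewrite tofrac_eq0 denom_ratioP.
apply: (canRL (mulfK d0)); unlock tofrac.
rewrite -[LHS]pi_mul; apply/eqmodP => /=.
rewrite FracField.equivfE /FracField.mulf.
by rewrite !numden_Ratio ?mulr1 ?oner_eq0 ?denom_ratioP // mulrC.
Qed.

(** The square of the product of the two denominators clears them. *)
Lemma two_squares_fraction (D : idomainType) (u : D) :
  two_squares (tofrac u) -> exists2 e : D, e != 0 & two_squares (u * e ^+ 2).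
Proof.
move=> [c [d uE]]; have [c1 [c2 [c20 cE]]] := fractionP c.
have [d1 [d2 [d20 dE]]] := fractionP d.
exists (c2 * d2); first by rewrite mulf_neq0.
exists (c1 * d2), (d1 * c2); apply/eqP; rewrite -tofrac_eq; apply/eqP.
rewrite tofracM uE cE dE !(tofracD, tofracXn, tofracM).
have clear_den (F : fieldType) (x y z t : F) : y != 0 -> t != 0 ->
    ((x / y) ^+ 2 + (z / t) ^+ 2) * (y * t) ^+ 2 = (x * t) ^+ 2 + (z * y) ^+ 2.
  by move=> y0 t0; field; rewrite t0 y0.
by rewrite clear_den ?tofrac_eq0.
Qed.

Section SumsOfSquares.
Variable p : prime_number.
Local Notation q := (val p).
Implicit Types (x y u : padic_int p).

Lemma Fp2_neq0 : odd q -> (2 : 'F_q) != 0.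
Proof.
move=> oq; rewrite (Fp_natr_eq 2 0) ?(valP p) // mod0n modn_small //.
have := prime_gt1 (valP p); have : q <> 2%N by move=> q2; rewrite q2 in oq.
by lia.
Qed.

Lemma padic_sqrt u (s : 'F_q) : odd q -> s != 0 -> s ^+ 2 = reduction u ->
  exists x, x ^+ 2 = u.
Proof.
move=> oq s0 su; have [t tE] := reduction_surj s.
have [||x] := @hensel_quadratic p 0 u t.
- apply/eqP; rewrite -reduction_eq0 rmorphB rmorphD rmorphXn rmorphM rmorph0 /=.
  by rewrite tE su mul0r addr0 subrr.
- rewrite addr0 unit_reduction rmorphMn /= tE -mulr_natr.
  by rewrite mulf_neq0 ?Fp2_neq0.
by rewrite mul0r addr0 => xu; exists x.
Qed.

Lemma unit_two_squares u : odd q -> u \is a GRing.unit -> two_squares u.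
Proof.
move=> oq; rewrite unit_reduction => u0.
have [s [t]] := Fp_sum_two_squares (reduction u) (valP p) oq.
(* Hensel lifting adjusts [s] against a fixed lift of [t], so [s] has to be nonzero. Since [u] is a
   unit, one of the two is, and they can be exchanged. *)
wlog s0 : s t / s != 0 => [hw|] st.
  have [s0|] := eqVneq s 0; last by move=> s0; apply: (hw s t).
  apply: (hw t s); last by rewrite addrC.
  by apply: contraNneq u0 => t0; rewrite -st s0 t0 expr0n addr0.
have [t' t'E] := reduction_surj t.
have [|x xE] := padic_sqrt (u := u - t' ^+ 2) oq s0.
  by rewrite rmorphB rmorphXn /= t'E -st addrK.
by exists x, t'; rewrite xE subrK.
Qed.

Lemma padic_sqrtN1 : (q %% 4 = 1)%N -> exists i : padic_int p, i ^+ 2 = -1.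
Proof.
move=> q1; have [s sE] := Fp_sqrtN1 (valP p) q1.
apply: (@padic_sqrt _ s); first by rewrite (divn_eq q 4) q1 oddD oddM andbF.
  apply: contra_eq_neq sE => ->.
  by rewrite expr0n eq_sym oppr_eq0 oner_eq0.
by rewrite rmorphN rmorph1.
Qed.

Lemma padic2_unit : odd q -> (2 : padic_int p) \is a GRing.unit.
Proof. by move=> oq; rewrite unit_reduction rmorph_nat Fp2_neq0. Qed.

(** With i^2 = -1 the form c^2 + d^2 is hyperbolic, and u = ((u+1)/2)^2 - ((u-1)/2)^2. *)
Lemma two_squares_mod4_1 u : (q %% 4 = 1)%N -> two_squares u.
Proof.
move=> q1; have [i iE] := padic_sqrtN1 q1.
have u2 : (2 : padic_int p) \is a GRing.unit.
  by apply: padic2_unit; rewrite (divn_eq q 4) q1 oddD oddM andbF.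
exists ((u + 1) / 2), (i * (u - 1) / 2).
have e4 (v : padic_int p) : (v / 2) ^+ 2 = v ^+ 2 / 4.
  by rewrite exprMn exprVn -natrX.
rewrite !e4 exprMn iE mulN1r -mulrDl.
have -> : (u + 1) ^+ 2 - (u - 1) ^+ 2 = u * 4 by ring.
by rewrite mulrK // -[4]/((2 * 2)%:R) natrM unitrM u2.
Qed.

(** Descent on the valuation of [e]: as long as p divides [c], [d] and [e], the equation can be
    divided by p^2. *)
Lemma primitive_two_squares u (e : padic_int p) : e != 0 ->
  two_squares (u * e ^+ 2) -> exists c d f,
    [\/ reduction c != 0, reduction d != 0 | reduction f != 0] /\
    u * f ^+ 2 = c ^+ 2 + d ^+ 2.
Proof.
move=> /padic_factor[k [v [uv ->]]]; elim: k => [|k IH] [c [d E]].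
  exists c, d, v; split; last by rewrite -E expr0 mul1r.
  by apply: Or33; rewrite -unit_reduction.
have [c0|c0] := eqVneq (reduction c) 0; last first.
  by exists c, d, (q%:R ^+ k.+1 * v); split => //; apply: Or31.
have [d0|d0] := eqVneq (reduction d) 0; last first.
  by exists c, d, (q%:R ^+ k.+1 * v); split => //; apply: Or32.
have [c' cE] := reduction_eq0_dvd c0; have [d' dE] := reduction_eq0_dvd d0.
apply: IH; exists c', d'; apply: (mulfI (expf_neq0 2 (padic_p_neq0 p))).
by rewrite mulrDr -!exprMn -cE -dE -E (exprS _ k); ring.
Qed.

(** In a primitive solution of p u f^2 = c^2 + d^2, p divides [c] and [d] because -1 is not a square
    modulo p; then p divides [f] as well, a contradiction. *)
Lemma not_two_squares_odd_valuation k u : (q %% 4 = 3)%N -> odd k ->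
  u \is a GRing.unit -> ~ two_squares (tofrac (q%:R ^+ k * u)).
Proof.
move=> q3 ok uu /two_squares_fraction[e e0 E].
have pm0 : q%:R ^+ k./2 * e != 0 by rewrite mulf_neq0 ?expf_neq0 ?padic_p_neq0.
(* The even part of q^k is absorbed into the square, which leaves valuation one. *)
have E' : two_squares (q%:R * u * (q%:R ^+ k./2 * e) ^+ 2).
  have qk : q%:R ^+ k = q%:R * (q%:R ^+ k./2) ^+ 2 :> padic_int p.
    by rewrite -exprM muln2 -exprS -[in LHS](odd_double_half k) ok.
  by move: E; rewrite qk; congr two_squares; ring.
have [c [d [f [h]]]] := primitive_two_squares pm0 E'.
move=> E2; have := congr1 (@reduction p) E2.
rewrite rmorphM rmorphD !rmorphXn rmorphM /= reduction_p !mul0r => /esym.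
move=> /(Fp_sum_squares_eq0 (valP p) q3)[c0 d0].
case: h; rewrite ?c0 ?d0 ?eqxx // => f0.
have [c' cE] := reduction_eq0_dvd c0; have [d' dE] := reduction_eq0_dvd d0.
have : u * f ^+ 2 = q%:R * (c' ^+ 2 + d' ^+ 2).
  apply: (mulfI (padic_p_neq0 p)); rewrite mulrA E2 cE dE; ring.
move/(congr1 (@reduction p)).
rewrite rmorphM [in RHS]rmorphM rmorphXn /= reduction_p mul0r.
by apply/eqP; rewrite mulf_neq0 ?sqrf_eq0 // -unit_reduction.
Qed.

End SumsOfSquares.

(** * The place 2 *)

Lemma Zp_natr_eq (m i j : nat) : (1 < m)%N ->
  (i%:R == j%:R :> 'Z_m) = (i == j %[mod m])%N.
Proof. by move=> m1; rewrite -val_eqE /= !val_Zp_nat. Qed.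

Lemma Z8_natr (x : 'Z_8) : exists2 i, (i < 8)%N & x = i%:R.
Proof. by exists (nat_of_ord x); [exact: ltn_ord | rewrite natr_Zp]. Qed.

Lemma all_iota (P : pred nat) m :
  all P (iota 0 m) -> forall i, (i < m)%N -> P i.
Proof. by move=> /allP h i im; apply: h; rewrite mem_iota. Qed.

(** Modulo 8 an odd class has square 1 and an even class has cube 0, so all odd exponents from 3 on
    act alike. *)
Lemma Z8_expr (x : 'Z_8) m : odd m -> (3 <= m)%N -> x ^+ m = x ^+ 3.
Proof.
move=> om m3; rewrite -(odd_double_half m) om -muln2.
have : (0 < m./2)%N by lia.
elim: (m./2) => [//|[//|k] IH] _.
rewrite (_ : (1 + k.+2 * 2 = (1 + k.+1 * 2) + 2)%N); last by lia.
rewrite exprD IH // -exprD; have [i i8 ->] := Z8_natr x.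
apply/eqP; rewrite -!natrX Zp_natr_eq //.
by move: i i8; apply: all_iota.
Qed.

Lemma Z8_expr6 m : (3 <= m)%N -> (6 : 'Z_8) ^+ m = 0.
Proof.
move=> m3; rewrite -(subnK m3) exprD (_ : 6 ^+ 3 = 0 :> 'Z_8) ?mulr0 //.
by apply/eqP; rewrite -natrX (Zp_natr_eq _ 0).
Qed.

Lemma intr_Z8_6 (n : int) : (n = 6 %[mod 8])%Z -> n%:~R = 6 :> 'Z_8.
Proof.
move=> n6; rewrite (divz_eq n 8) n6 intrD intrM.
rewrite (_ : 8%:~R = 0 :> 'Z_8) ?mulr0 ?add0r //.
by apply/eqP; rewrite -[_%:~R]/(8%:R) (Zp_natr_eq _ 0).
Qed.

(** Integers in these classes are 3 mod 4, or twice a number that is 3 mod 4. *)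
Definition mod8_3_6_7 : {pred 'Z_8} := [pred x | [|| x == 3, x == 6 | x == 7]].

Lemma all4_iota (m : nat) (P : nat -> nat -> nat -> nat -> bool) :
  all (fun i => all (fun j => all (fun k => all (P i j k) (iota 0 m))
    (iota 0 m)) (iota 0 m)) (iota 0 m) ->
  forall i j k l, (i < m)%N -> (j < m)%N -> (k < m)%N -> (l < m)%N -> P i j k l.
Proof.
move=> h i j k l im jm km lm.
move/all_iota/(_ i im)/all_iota/(_ j jm)/all_iota/(_ k km)/all_iota: h.
exact.
Qed.

(** Here [w] is n - z^b modulo 8, with n^a reduced to 0 and both powers of z to z^3. The finitely
    many cases are computed. *)
Lemma Z8_curve (x y z w : 'Z_8) : x ^+ 2 + y ^+ 2 + z ^+ 3 = 0 ->
  w + z ^+ 3 = 6 -> w \in mod8_3_6_7.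
Proof.
have [[i i8 ->] [j j8 ->]] := (Z8_natr x, Z8_natr y).
have [[k k8 ->] [l l8 ->]] := (Z8_natr z, Z8_natr w).
move=> /eqP + /eqP.
rewrite inE -!natrX -!natrD (Zp_natr_eq _ 0) // !Zp_natr_eq //.
move=> e1 e2; have /(_ i j k l i8 j8 k8 l8) := @all4_iota 8 (fun i j k l =>
  (i ^ 2 + j ^ 2 + k ^ 3 == 0 %[mod 8]) ==> (l + k ^ 3 == 6 %[mod 8]) ==>
  [|| l == 3 %[mod 8], l == 6 %[mod 8] | l == 7 %[mod 8]])%N isT.
by rewrite e1 e2.
Qed.

(** Excludes primitive solutions modulo 8, to contradict [primitive_two_squares]. *)
Lemma Z8_not_two_squares (u c d f : 'Z_8) : u \in mod8_3_6_7 ->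
  u * f ^+ 2 = c ^+ 2 + d ^+ 2 ->
  [/\ ~~ odd c, ~~ odd d & ~~ odd f].
Proof.
have [[i i8 ->] [j j8 ->]] := (Z8_natr u, Z8_natr c).
have [[k k8 ->] [l l8 ->]] := (Z8_natr d, Z8_natr f).
move=> + /eqP.
rewrite inE -!natrX -!natrM -!natrD  !Zp_natr_eq // !val_Zp_nat // => ui e.
have /(_ i j k l i8 j8 k8 l8) := @all4_iota 8 (fun i j k l =>
  [|| i == 3 %[mod 8], i == 6 %[mod 8] | i == 7 %[mod 8]] ==>
  (i * l ^ 2 == j ^ 2 + k ^ 2 %[mod 8]) ==>
  [&& ~~ odd (j %% 8), ~~ odd (k %% 8) & ~~ odd (l %% 8)])%N isT.
by rewrite ui e => /and3P.
Qed.

Section AtTwo.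
Variable h2 : prime 2.
Let p : prime_number := exist _ 2 h2.

Lemma residue_two_odd (x : padic_int p) :
  (reduction x != 0) = odd (nat_of_ord (residue x 2)).
Proof. by rewrite reduction_eq0 -(dvdn_residue x 2) -[RHS]negbK -dvdn2. Qed.

Lemma two_not_two_squares (u : padic_int p) : residue u 2 \in mod8_3_6_7 ->
  ~ two_squares (tofrac u).
Proof.
move=> u2 /two_squares_fraction[e e0 /(primitive_two_squares e0)].
move=> [c [d [f [h E]]]].
have := congr1 (fun x => residue x 2) E.
rewrite residueM residueD !residueX => /(Z8_not_two_squares u2).
by rewrite -!residue_two_odd => -[/negP ? /negP ? /negP ?]; case: h.
Qed.

Lemma two_sqrt (u : padic_int p) : residue u 2 = 1 -> exists x, x ^+ 2 = u.
Proof.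
move=> u1; have [|e uE] := @residue_eq0_dvd p (u - 1) 2.
  by rewrite residueB u1 subrr.
(* With u = 1 + 8e, the equation (1 + 2x)^2 = u becomes x^2 + x = 2e, which has the root 0 modulo 2
   with derivative 1. *)
have [||x xE] := @hensel_quadratic p 1 (2 * e) 0.
- rewrite residueB residueD residueM.
  rewrite (_ : residue (2 * e) 0 = 0) ?subr0 ?residueX ?mulr0 ?expr0n ?addr0 //.
  have /eqP two0 : (2%:R : 'Z_(val p ^ 1)) == 0 by rewrite residue_natr_eq0.
  by rewrite residueM (residue_nat p 2) two0 mul0r.
- by rewrite mul0rn add0r unitr1.
exists (1 + 2 * x); rewrite -[u](subrK 1) uE.
have -> : (val p ^ 3)%:R * e + 1 = 1 + 4 * (2 * e) :> padic_int p.
  by rewrite -[(_ ^ _)%N]/8%N; ring.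
by rewrite -xE; ring.
Qed.

Lemma curve_residue (a b : nat) (n : int)
    (P : padic_int p * padic_int p * padic_int p) :
  (3 <= a)%N -> (3 <= b)%N -> odd a -> odd b -> (n = 6 %[mod 8])%Z ->
  scheme_points a b n _ P -> residue (n%:~R - P.2 ^+ b) 2 \in mod8_3_6_7.
Proof.
move=> a3 b3 oa ob n6; case: P => [[x y] z]; rewrite /scheme_points /= => E.
(* Index 2 means modulo 2^3 = 8. *)
have := congr1 (fun x => residue x 2) E.
rewrite !residueD !residueX residue_int intr_Z8_6 // Z8_expr6 //.
rewrite (@Z8_expr _ (a * b)) ?oddM ?oa //; last by nia.
move=> h; apply: (Z8_curve h).
by rewrite (@Z8_expr _ b) // subrK.
Qed.

End AtTwo.

(** * The cofactor g *)

(** This is (x^a - y^a)/(x - y), and g(Z) is its value at (n, Z^b). A general ring is allowed so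
    that g can be studied inside Z_p. *)
Definition geometric_form (D : comNzRingType) (a : nat) (x y : D) : D :=
  \sum_(i < a) x ^+ (a - 1 - i) * y ^+ i.

Lemma cofactor_poly_rmorph (D : comNzRingType) (K : fieldType)
    (f : {rmorphism D -> K}) (a b : nat) (n : int) (z : D) :
  cofactor_poly a b n (f z) = f (geometric_form a n%:~R (z ^+ b)).
Proof.
rewrite rmorph_sum; apply: eq_bigr => i _.
by rewrite rmorphM !rmorphXn rmorph_int -exprM mulnC.
Qed.

Lemma subrXX_geometric_form (D : comNzRingType) (a : nat) (x y : D) :
  x ^+ a - y ^+ a = (x - y) * geometric_form a x y.
Proof.
by rewrite subrXX; congr (_ * _); apply: eq_bigr => i _; rewrite subn1.
Qed.

(** Each term is x^(a-1) modulo x - y, because x - y divides x^i - y^i. This gives g = a n^(a-1)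
    modulo n - z^b. *)
Lemma geometric_form_diag (D : comNzRingType) (a : nat) (x y : D) :
  exists h, geometric_form a x y = a%:R * x ^+ a.-1 + (x - y) * h.
Proof.
exists (- \sum_(i < a) x ^+ (a - 1 - i) * geometric_form i x y).
have -> : a%:R * x ^+ a.-1 = \sum_(i < a) x ^+ a.-1.
  by rewrite sumr_const card_ord mulr_natl.
rewrite mulrN mulr_sumr -sumrB; apply: eq_bigr => i _.
rewrite mulrCA -subrXX_geometric_form mulrBr -exprD.
by rewrite (_ : a - 1 - i + i = a.-1)%N ?subKr //; case: i => i /=; lia.
Qed.

(** Homogeneity of degree a-1: for odd [a] the factor taken out is a square. *)
Lemma geometric_form_scale (D : comNzRingType) (a : nat) (t x y : D) :
  geometric_form a (t * x) (t * y) = t ^+ a.-1 * geometric_form a x y.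
Proof.
rewrite mulr_sumr; apply: eq_bigr => i _.
rewrite !exprMn mulrACA -exprD subnK ?subn1 //.
by case: i => i /=; lia.
Qed.

Lemma geometric_form_x0 (D : comNzRingType) (a : nat) (x : D) :
  (0 < a)%N -> geometric_form a x 0 = x ^+ a.-1.
Proof.
case: a => // a _; rewrite /geometric_form big_ord_recl big1 => [|i _].
  by rewrite expr0 mulr1 addr0 subn1 subn0.
by rewrite exprS mul0r mulr0.
Qed.

Lemma geometric_form_0x (D : comNzRingType) (a : nat) (x : D) :
  (0 < a)%N -> geometric_form a 0 x = x ^+ a.-1.
Proof.
case: a => // a _; rewrite /geometric_form big_ord_recr big1 => [|i _] /=.
  by rewrite subn1 subnn expr0 mul1r add0r.
rewrite expr0n (_ : (a.+1 - 1 - i == 0)%N = false) ?mul0r //.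
by case: i => i /=; lia.
Qed.

Lemma geometric_form_rmorph (D E : comNzRingType) (f : {rmorphism D -> E})
    (a : nat) (x y : D) :
  f (geometric_form a x y) = geometric_form a (f x) (f y).
Proof.
by rewrite rmorph_sum; apply: eq_bigr => i _; rewrite rmorphM !rmorphXn.
Qed.

Lemma half_neq0 : to_rat_mod_int (1 / 2) != 0.
Proof. by rewrite to_rat_mod_int_eq0. Qed.

Lemma inv_quaternion_eq0 (K : fieldType) (u : K) :
  inv_quaternion u = 0 <-> two_squares u.
Proof.
rewrite /inv_quaternion /hilbert_m1; split; last first.
  by move=> h; rewrite ifT // asboolT.
by case: asboolP => //= _ /eqP; rewrite (negPf half_neq0).
Qed.

(** * Odd places *)

Section OddPlaces.
Variable p : prime_number.
Local Notation q := (val p).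

Lemma padic_natr_neq0 m : (0 < m)%N -> (m%:R : padic_int p) != 0.
Proof.
(* Index m detects m, since 0 < m < q^(m+1). *)
move=> m0; apply/eqP => e; have := residue_nat p m m; rewrite e => /esym/eqP.
rewrite residue_natr_eq0 => /(dvdn_leq m0); rewrite leqNgt.
by rewrite (leq_trans (ltn_expl m (padic_p_gt1 p))) // leq_exp2l ?padic_p_gt1.
Qed.

Lemma padic_natr_unit m :
  ((m%:R : padic_int p) \is a GRing.unit) = ~~ (q %| m)%N.
Proof.
by rewrite unit_reduction rmorph_nat (Fp_natr_eq _ 0) ?(valP p) // mod0n.
Qed.

Lemma padic_intr_sign (m : int) : exists2 e : padic_int p, e \is a GRing.unit &
  m%:~R = e * `|m|%:R.
Proof.
case: m => m; first by exists 1; rewrite ?unitr1 ?mul1r.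
by exists (-1); rewrite ?unitrN1 // NegzE abszN absz_nat mulN1r mulrNz.
Qed.

Lemma padic_intr_unit (m : int) :
  ((m%:~R : padic_int p) \is a GRing.unit) = ~~ (q %| `|m|)%N.
Proof.
have [e ue ->] := padic_intr_sign m.
by rewrite unitrM ue padic_natr_unit.
Qed.

Lemma geometric_form_unit (a : nat) (x y : padic_int p) : (0 < a)%N ->
  x \is a GRing.unit -> reduction y = 0 ->
  geometric_form a x y \is a GRing.unit /\
  geometric_form a y x \is a GRing.unit.
Proof.
move=> a0; rewrite !unit_reduction => x0 y0.
rewrite !geometric_form_rmorph /= y0.
by rewrite geometric_form_x0 // geometric_form_0x // expf_neq0.
Qed.

(** As b does not divide l, [x] and z^b have different valuations. Taking out the smaller power of p
    leaves a form with exactly one unit argument, hence a unit; the factor taken out is a square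
    because a-1 is even. *)
Lemma geometric_form_two_squares (a b l : nat) (x z u : padic_int p) :
  odd q -> odd a -> (0 < b)%N -> u \is a GRing.unit ->
  x = q%:R ^+ l * u -> ~~ (b %| l)%N ->
  geometric_form a x (z ^+ b) != 0 /\ two_squares (geometric_form a x (z ^+ b)).
Proof.
move=> oq oa b0 uu xE bl; have a0 : (0 < a)%N by case: (a) oa.
have scaled (k : nat) (y t : padic_int p) :
    geometric_form a y t \is a GRing.unit ->
    geometric_form a (q%:R ^+ k * y) (q%:R ^+ k * t) != 0 /\
    two_squares (geometric_form a (q%:R ^+ k * y) (q%:R ^+ k * t)).
  move=> ug; rewrite geometric_form_scale.
  have -> : (q%:R ^+ k) ^+ a.-1 = (q%:R ^+ (k * a./2)) ^+ 2 :> padic_int p.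
    by rewrite -!exprM -mulnA; congr (_ ^+ (k * _)); lia.
  split; last exact/two_squares_sqrM/unit_two_squares.
  rewrite mulf_neq0 ?expf_neq0 ?padic_p_neq0 //.
  by apply: contraTneq ug => ->; rewrite unitr0.
have red0 (k : nat) (t : padic_int p) :
    (0 < k)%N -> reduction (q%:R ^+ k * t) = 0.
  by case: k => // k _; rewrite rmorphM rmorphXn /= reduction_p exprS !mul0r.
(* z = 0 has no finite valuation and is treated apart. *)
have [z0|z0] := eqVneq z 0.
  have [ug _] := geometric_form_unit a0 uu (rmorph0 (@reduction p)).
  by have := scaled l _ _ ug; rewrite mulr0 -xE z0 expr0n gtn_eqF.
have [k [v [uv zE]]] := padic_factor z0.
have {}zE : z ^+ b = q%:R ^+ (k * b) * v ^+ b by rewrite zE exprMn -exprM.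
have uvb : v ^+ b \is a GRing.unit by rewrite unitrX.
have [lt|gt|eq] := ltngtP (k * b)%N l; last by rewrite -eq dvdn_mull in bl.
  have d0 : (0 < l - k * b)%N by rewrite subn_gt0.
  have [_ ug] := geometric_form_unit a0 uvb (red0 _ u d0).
  have := scaled (k * b)%N _ _ ug.
  by rewrite mulrA -exprD subnKC 1?ltnW // -xE -zE.
have d0 : (0 < k * b - l)%N by rewrite subn_gt0.
have [ug _] := geometric_form_unit a0 uu (red0 _ (v ^+ b) d0).
have := scaled l _ _ ug.
by rewrite mulrA -exprD subnKC 1?ltnW // -xE -zE.
Qed.

End OddPlaces.

(** * The local invariant at finite places *)

Section FinitePlaces.
Variables (R : realType) (p : prime_number) (a b : nat) (n : int).
Local Notation q := (val p).
Local Notation v := (FinitePlace p).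
Variable P : padic_int p * padic_int p * padic_int p.
Hypothesis curveP : scheme_points a b n (padic_int p) P.

Local Notation invP := (@inv_A a b n (local_field R v) (@local_point R v P)).

Lemma inv_A_eq0_linear : n%:~R - P.2 ^+ b != 0 ->
  (invP = 0 <-> two_squares (tofrac (n%:~R - P.2 ^+ b))).
Proof.
move=> nz.
have e : n%:~R - tofrac P.2 ^+ b = tofrac (n%:~R - P.2 ^+ b) :> local_field R v.
  by rewrite /= rmorphB rmorphXn rmorph_int.
rewrite -inv_quaternion_eq0 inv_A_chart1 /= ?e //.
by rewrite -subr_eq0 e tofrac_eq0.
Qed.

Lemma inv_A_eq0_cofactor : geometric_form a n%:~R (P.2 ^+ b) != 0 ->
  two_squares (geometric_form a n%:~R (P.2 ^+ b)) -> invP = 0.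
Proof.
move=> g0 sg; rewrite inv_A_chart2.
- apply/inv_quaternion_eq0; rewrite /= cofactor_poly_rmorph.
  exact: two_squares_rmorph.
- exact: (@local_pointP R a b n v P).
- by rewrite /= cofactor_poly_rmorph tofrac_eq0.
Qed.

Lemma inv_A_odd : odd q -> odd a -> (0 < b)%N -> n != 0 ->
  (prime q -> (q = 3 %[mod 4])%N -> (q %| a%:Z * n)%Z ->
    ~~ (b %| logn q `|n|%N)%N) ->
  invP = 0.
Proof.
move=> oq oa b0 n0 hv; set w := P.2 ^+ b.
have a0 : (0 < a)%N by case: (a) oa.
have nn0 : (0 < `|n|)%N by rewrite absz_gt0.
have nZ : (n%:~R : padic_int p) != 0.
  have [e ue ->] := padic_intr_sign p n.
  rewrite mulf_neq0 ?padic_natr_neq0 //.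
  by apply: contraTneq ue => ->; rewrite unitr0.
have [h gE] := @geometric_form_diag (padic_int p) a n%:~R w.
have [q1|q1] := eqVneq (q %% 4)%N 1%N.
  have [nw|nw] := eqVneq (n%:~R - w) 0.
    apply: inv_A_eq0_cofactor; last exact: two_squares_mod4_1.
    by rewrite gE nw mul0r addr0 mulf_neq0 ?expf_neq0 ?padic_natr_neq0.
  apply/inv_A_eq0_linear => //.
  exact/(@two_squares_rmorph _ _ (@tofrac (padic_int p)))/two_squares_mod4_1.
have q3 : (q = 3 %[mod 4])%N.
  have : (q %% 2 = 1)%N by rewrite modn2 oq.
  by move: (q) q1 => r; lia.
have {}hv := hv (valP p) q3.
(* If p divides a but not n, then [hv] would deny that b divides 0, so that case is void. *)
have [qan|] := boolP (q %| a%:Z * n)%Z.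
  have bl := hv qan.
  have [m' cm nE] := pfactor_coprime (valP p) nn0.
  have [e ue neE] := padic_intr_sign p n.
  have um : e * m'%:R \is a GRing.unit.
    by rewrite unitrM ue padic_natr_unit -prime_coprime ?(valP p).
  have xE : n%:~R = q%:R ^+ logn q `|n| * (e * m'%:R) :> padic_int p.
    by rewrite neE {1}nE natrM natrX; ring.
  have [g0 sg] := geometric_form_two_squares P.2 oq oa b0 um xE bl.
  exact: inv_A_eq0_cofactor.
rewrite dvdzE abszM /= Euclid_dvdM ?(valP p) // negb_or => /andP[qa qn].
have [r0|r0] := eqVneq (reduction (n%:~R - w)) 0.
  have ug : geometric_form a n%:~R w \is a GRing.unit.
    rewrite gE unit_reduction rmorphD [X in _ + X]rmorphM /= r0.
    rewrite mul0r addr0.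
    by rewrite -unit_reduction unitrM padic_natr_unit qa unitrX //
      padic_intr_unit.
  apply: inv_A_eq0_cofactor; last exact: unit_two_squares.
  by apply: contraTneq ug => ->; rewrite unitr0.
have uw : n%:~R - w \is a GRing.unit by rewrite unit_reduction.
apply/inv_A_eq0_linear; first by apply: contraTneq uw => ->; rewrite unitr0.
exact/(@two_squares_rmorph _ _ (@tofrac (padic_int p)))/unit_two_squares.
Qed.

End FinitePlaces.

(** * The real place *)

Lemma odd_exprn_lt (R : realDomainType) (m : nat) (x y : R) :
  odd m -> x < y -> x ^+ m < y ^+ m.
Proof.
move=> om xy; have m0 : (0 < m)%N by case: (m) om.
have [x0|x0] := leP 0 x.
  by rewrite ltrXn2r ?gtn_eqF //; exact: le_trans x0 (ltW xy).
have [y0|y0] := leP y 0; last first.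
  by apply: (@lt_trans _ _ 0); rewrite ?exprn_odd_lt0 ?exprn_odd_gt0.
(* For x < y <= 0 the nonnegative case is applied to -y < -x; odd powers commute with the sign. *)
have := @ltrXn2r _ m (- y) (- x); rewrite (exprNn x) (exprNn y).
rewrite -signr_odd om expr1 !mulN1r !ltrN2.
by rewrite oppr_ge0 y0 xy gtn_eqF //; apply.
Qed.

(** n^a - (z^b)^a = x^2 + y^2 is nonnegative and odd powers are strictly increasing. A general
    ordered ring serves both real and integral points. *)
Lemma curve_linear_ge0 (R : realDomainType) (a b : nat) (x y z n : R) :
  odd a -> x ^+ 2 + y ^+ 2 + z ^+ (a * b) = n ^+ a -> 0 <= n - z ^+ b.
Proof.
move=> oa E; rewrite subr_ge0 leNgt; apply/negP => /(odd_exprn_lt oa).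
have zE : (z ^+ b) ^+ a = z ^+ (a * b) by rewrite -exprM mulnC.
rewrite zE -E => lt; have := addr_ge0 (sqr_ge0 x) (sqr_ge0 y).
by rewrite leNgt -(gtrDr (z ^+ (a * b))) lt.
Qed.

Lemma two_squares_ge0 (R : realType) (u : R) : 0 <= u -> two_squares u.
Proof.
by move=> u0; exists (Num.sqrt u), 0; rewrite sqr_sqrtr // expr0n addr0.
Qed.

Lemma inv_A_real (R : realType) (a b : nat) (n : int) (P : R * R * R) :
  odd a -> n != 0 -> scheme_points a b n R P -> inv_A a b n P = 0.
Proof.
move=> oa n0 curveP; have [nw|nw] := eqVneq (n%:~R : R) (P.2 ^+ b); last first.
  rewrite inv_A_chart1 //; apply/inv_quaternion_eq0/two_squares_ge0.
  exact: curve_linear_ge0 oa curveP.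
(* When n = z^b, g = a n^(a-1) is positive because a-1 is even. *)
have gE : cofactor_poly a b n P.2 = a%:R * n%:~R ^+ a.-1.
  have -> : cofactor_poly a b n P.2 = geometric_form a n%:~R (P.2 ^+ b).
    exact: (@cofactor_poly_rmorph R R idfun).
  have [h ->] := @geometric_form_diag R a n%:~R (P.2 ^+ b).
  by rewrite nw subrr mul0r addr0.
have g0 : 0 < cofactor_poly a b n P.2.
  have a0 : (0 < a)%N by case: (a) oa.
  rewrite gE mulr_gt0 ?ltr0n // lt0r expf_neq0 ?intr_eq0 //= exprn_even_ge0 //.
  by case: (a) oa.
rewrite inv_A_chart2 ?gt_eqF //.
by apply/inv_quaternion_eq0/two_squares_ge0/ltW.
Qed.

Lemma curve_rmorph (D E : comNzRingType) (f : {rmorphism D -> E}) (a b : nat)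
    (n : int) (x y z : D) :
  scheme_points a b n D (x, y, z) -> scheme_points a b n E (f x, f y, f z).
Proof.
rewrite /scheme_points /= => /(congr1 f).
by rewrite !rmorphD !rmorphXn rmorph_int.
Qed.

(** * Integral and local points *)

(** If every prime 3 mod 4 had even exponent, each prime power in the odd number [m] would be 1 mod
    4, and so would [m]. *)
Lemma prime_mod4_3_odd_logn (m : nat) : (m %% 4 = 3)%N ->
  exists p, [/\ prime p, (p %% 4 = 3)%N & odd (logn p m)].
Proof.
move=> m3; apply: contrapT => nex.
have m0 : (0 < m)%N by case: m m3 nex.
suff : (m %% 4 = 1)%N by rewrite m3.
rewrite {1}(prod_prime_decomp m0) prime_decompE big_map big_seq.
elim/big_ind: _ => [//|x y x1 y1|p]; first by rewrite -modnMm x1 y1.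
rewrite mem_primes => /and3P[pp _ pm] /=.
have op : (p %% 2 = 1)%N.
  by rewrite modn2 (dvdn_odd pm) //; lia.
have [p1|p1] := eqVneq (p %% 4)%N 1%N; first by rewrite -modnXm p1 exp1n.
have p3 : (p %% 4 = 3)%N by lia.
have /negP el : ~ odd (logn p m) by move=> ol; apply: nex; exists p.
rewrite -(odd_double_half (logn p m)) (negPf el) add0n -muln2 mulnC expnM.
by rewrite -modnXm -[(p ^ 2)%N]mulnn -modnMm p3 exp1n.
Qed.

(** A number that is 6 mod 8 is twice one that is 3 mod 4, and the factor 2 does not affect
    exponents at odd primes. *)
Lemma mod8_odd_logn (m : nat) : m%:R \in mod8_3_6_7 ->
  exists p, [/\ prime p, (p %% 4 = 3)%N & odd (logn p m)].
Proof.
rewrite inE !(@Zp_natr_eq 8) // => h.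
have [m3|m6] : (m %% 4 = 3)%N \/ (m %% 8 = 6)%N by lia.
  exact: prime_mod4_3_odd_logn.
have [|p [pp p3 ol]] := @prime_mod4_3_odd_logn (m %/ 2); first by lia.
exists p; split=> //; have -> : (m = 2 * (m %/ 2))%N by lia.
rewrite lognM; [|lia..].
by rewrite logn_prime // (_ : (p == 2%N) = false) //; apply/eqP; lia.
Qed.

(** * Solubility at every place *)

Section Solubility.
Variables (R : realType) (a b : nat) (n : int).
Hypotheses (a3 : (3 <= a)%N) (b3 : (3 <= b)%N) (oa : odd a) (ob : odd b).
Hypothesis n6 : (n = 6 %[mod 8])%Z.

Lemma int_mod8_6_neq0 : n != 0.
Proof. by apply: contra_eq_neq n6 => ->. Qed.

Lemma real_point : scheme_points a b n R !=set0.
Proof.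
(* With z = -|n| and ab odd, x^2 has to be n^a + |n|^(ab), which is nonnegative because |n| >= 1 and
   ab >= a. *)
pose u : R := n%:~R ^+ a + `|n%:~R| ^+ (a * b).
have u0 : 0 <= u.
  rewrite -[X in 0 <= X]opprK oppr_ge0 opprD subr_le0.
  apply: le_trans (ler_norm _) _; rewrite normrN normrX.
  rewrite ler_weXn2l //; last by nia.
  by rewrite -intr_norm ler1z -gtz0_ge1 normr_gt0 int_mod8_6_neq0.
exists (Num.sqrt u, 0, - `|n%:~R|); rewrite /scheme_points /=.
rewrite sqr_sqrtr // expr0n addr0 exprNn -signr_odd oddM oa ob expr1 mulN1r.
by rewrite addrK.
Qed.

(** z is chosen to make n^a - z^(ab) a sum of two squares: 0 for odd p prime to n and 1 for odd p
    dividing n, both giving a unit; -1 for p = 2, giving 1 modulo 8, a square. *)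
Lemma padic_point (p : prime_number) : scheme_points a b n (padic_int p) !=set0.
Proof.
have a0 : (0 < a)%N by case: (a) oa.
have ab0 : (0 < a * b)%N by nia.
have point (z : padic_int p) : two_squares (n%:~R ^+ a - z ^+ (a * b)) ->
    scheme_points a b n (padic_int p) !=set0.
  move=> [x [y e]]; exists (x, y, z); rewrite /scheme_points /=.
  by rewrite -e subrK.
have [op|] := boolP (odd (val p)).
  have [qn|qn] := boolP (val p %| `|n|)%N; last first.
    apply: (point 0); apply: unit_two_squares => //.
    by rewrite expr0n gtn_eqF // subr0 unitrX // padic_intr_unit.
  apply: (point 1); apply: unit_two_squares => //.
  have n0 : reduction (n%:~R : padic_int p) = 0.
    by apply/eqP; rewrite -[_ == _]negbK -unit_reduction padic_intr_unit qn.
  rewrite unit_reduction rmorphB !rmorphXn /= n0 expr0n gtn_eqF //.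
  by rewrite sub0r rmorph1 expr1n oppr_eq0 oner_eq0.
case: p point => l pp point /= ol.
have l2 : l = 2%N by case: (even_prime pp) => // l_odd; rewrite l_odd in ol.
subst l; apply: (point (-1)).
have [|x xE] := @two_sqrt pp (n%:~R ^+ a - (-1) ^+ (a * b)).
  rewrite residueB !residueX residue_int intr_Z8_6 // Z8_expr6 //.
  by rewrite -residueX -signr_odd oddM oa ob expr1 sub0r; apply: opprK.
by exists x, 0; rewrite xE expr0n addr0.
Qed.

End Solubility.

(** * Absence of integral points and the sum of invariants *)

Lemma no_integral_point (R : realType) (a b : nat) (n x y z : int) :
  (3 <= a)%N -> (3 <= b)%N -> odd a -> odd b -> (n = 6 %[mod 8])%Z ->
  (forall p : nat, prime p -> p = 3 %[mod 4] ->
      (p %| a%:Z * n)%Z -> ~~ (b %| logn p `|n|%N)%N) ->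
  x ^+ 2 + y ^+ 2 + z ^+ (a * b) <> n ^+ a.
Proof.
move=> a3 b3 oa ob n6 hv E.
have curveP (p : prime_number) :
    scheme_points a b n (padic_int p) (x%:~R, y%:~R, z%:~R).
  apply: (@curve_rmorph int (padic_int p) intr); rewrite /scheme_points /=.
  by rewrite intz.
have intE (p : prime_number) :
    (n%:~R - z%:~R ^+ b : padic_int p) = (n - z ^+ b)%:~R.
  by rewrite rmorphB rmorphXn.
have := curve_linear_ge0 oa E; case NE : (n - z ^+ b) => [m|//] _.
have two_prime : prime 2 by [].
have := curve_residue a3 b3 oa ob n6 (curveP (exist _ 2%N two_prime)).
rewrite intE NE (residue_nat _ m) => /mod8_odd_logn[l [pl l3 ol]].
pose p : prime_number := exist _ l pl.
have m0 : (0 < m)%N by case: (m) ol; rewrite ?logn0.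
have [m' cm mE] := pfactor_coprime pl m0.
have um : (m'%:R : padic_int p) \is a GRing.unit.
  by rewrite padic_natr_unit -prime_coprime.
have mZ : (n%:~R - z%:~R ^+ b : padic_int p) = l%:R ^+ logn l m * m'%:R.
  by rewrite intE NE -[LHS]/(m%:R) {1}mE natrM natrX mulrC.
(* n - z^b has odd valuation at this p, whereas [inv_A_odd] makes it a sum of two squares in Q_p. *)
apply: (not_two_squares_odd_valuation (p := p) l3 ol um).
have odl : odd l by lia.
have n0 := int_mod8_6_neq0 n6.
have b0 : (0 < b)%N by case: (b) b3.
have inv0 := inv_A_odd R (curveP p) odl oa b0 n0 (hv l).
have nz : n%:~R - z%:~R ^+ b != 0 :> padic_int p.
  by rewrite intE NE padic_natr_neq0.
have [/(_ inv0)] := @inv_A_eq0_linear R p a b n (x%:~R, y%:~R, z%:~R) nz.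
by rewrite mZ.
Qed.

Lemma inv_A_two (R : realType) (a b : nat) (n : int) (h2 : prime 2)
    (v := FinitePlace (exist _ 2 h2))
    (P : local_ring R v * local_ring R v * local_ring R v) :
  (3 <= a)%N -> (3 <= b)%N -> odd a -> odd b -> (n = 6 %[mod 8])%Z ->
  scheme_points a b n (local_ring R v) P ->
  inv_A a b n (local_point P) = to_rat_mod_int (1 / 2).
Proof.
move=> a3 b3 oa ob n6 curveP.
have res := curve_residue a3 b3 oa ob n6 curveP.
have nts := two_not_two_squares res.
have nz : n%:~R - P.2 ^+ b != 0 :> padic_int (exist _ 2%N h2).
  apply/eqP => e; move: res; rewrite e; apply/negP.
  by rewrite inE.
have := @inv_A_eq0_linear R (exist _ 2%N h2) a b n P nz.
(* On either chart the only values are 0 and 1/2, and [nts] excludes 0. *)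
rewrite /inv_A; set c1 := (X in if X then _ else _).
case: c1 => [|]; rewrite /inv_quaternion; case: ifP => // _ [+ _].
all: by move=> /(_ erefl) /nts.
Qed.

Theorem theorem4p7 (R : realType) (a b : nat) (n : int)
    (ha : (3 <= a)%N) (hb : (3 <= b)%N) (odd_a : odd a) (odd_b : odd b)
    (hn : (n = 6 %[mod 8])%Z)
    (hv : forall p : nat, prime p -> p = 3 %[mod 4] ->
      (p %| a%:Z * n)%Z -> ~~ (b %| logn p `|n|%N)%N) :
  [/\ ~ (exists x y z : int, x ^+ 2 + y ^+ 2 + z ^+ (a * b) = n ^+ a),
      everywhere_locally_soluble R a b n,
      forall P : forall v : place,
          local_ring R v * local_ring R v * local_ring R v,
        (forall v : place, scheme_points a b n (local_ring R v) (P v)) ->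
        finite_set [set v | inv_A a b n (local_point (P v)) != 0] /\
        \sum_(v \in [set: place]) inv_A a b n (local_point (P v))
          = to_rat_mod_int (1 / 2)
    & ~ integral_Hasse_principle R a b n].
Proof.
have n0 := int_mod8_6_neq0 hn.
have b0 : (0 < b)%N by case: (b) hb.
have noZ x y z : x ^+ 2 + y ^+ 2 + z ^+ (a * b) <> n ^+ a.
  exact: (no_integral_point R ha hb odd_a odd_b hn hv).
have local : everywhere_locally_soluble R a b n.
  case=> [p|]; first exact: (padic_point ha hb odd_a odd_b hn p).
  exact: (real_point R ha hb odd_a odd_b hn).
split=> //; first by move=> [x [y [z]]]; apply: noZ.
- move=> P curveP; have h2 : prime 2 by [].
  pose v2 := FinitePlace (exist _ 2%N h2).
  have inv0 v : v <> v2 -> inv_A a b n (local_point (P v)) = 0.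
    case: v => [p|] vE; last exact: inv_A_real odd_a n0 (curveP InfinitePlace).
    apply: (inv_A_odd R (curveP (FinitePlace p))) => //.
      2: exact: (hv (val p)).
    (* A prime that is not odd is 2, and by irrelevance of primality proofs its place would be
       [v2]. *)
    have [p2|//] := even_prime (valP p).
    by case: vE; congr FinitePlace; apply: val_inj.
  split.
    apply: (@sub_finite_set _ _ [set v2]); last exact: finite_set1.
    move=> v /= /eqP invv; apply: contrapT => vv2; exact/invv/inv0.
  rewrite -(@fsbig_widen _ _ _ _ [set v2]) //; last first.
    by move=> v /= [_ vv2]; exact: inv0.
  by rewrite fsbig_set1; apply: inv_A_two.
- move=> /(_ local)[[[x y] z]]; rewrite /scheme_points /= intz; exact: noZ.
Qed.
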